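(* Let $V_1,\dots,V_{11}$ be the irreducible complex representations of $S_6$, numbered by the character table given in the context, and let $n\ge 1$ be an integer. For each $m\in\{3,4,\dots,11\}$, $$V_m^{\otimes n}\cong\bigoplus_{i=1}^{11} N^{(m)}_i(n)\,V_i ,$$ where the multiplicities $N^{(m)}_i(n)$ are as follows. In each case $c_{ij}$ denotes the $j$-th entry of the row labelled $V_i$ of the corresponding table. (1) $m=3$: $N^{(3)}_i(n)=\dfrac{c_{i1}(-1)^n+c_{i2}2^n+c_{i3}3^n+c_{i4}5^n+c_{i5}}{c_{i6}}$ with $$\begin{array}{c|cccccc} V_1&265&40&15&1&135&720\\ V_2&-5&40&-15&1&-45&720\\ V_3&-53&16&9&1&27&144\\ V_4&1&16&-9&1&-9&144\\ V_5&15&0&5&1&-5&80\\ V_6&5&0&-5&1&15&80\\ V_7&13&4&3&1&-9&72\\ V_8&-5&4&-3&1&-9&72\\ V_9&-11&-8&3&1&-9&144\\ V_{10}&7&-8&-3&1&27&144\\ V_{11}&-5&-5&0&1&0&45 \end{array}$$ (2) $m=4$: $N^{(4)}_i(n)=\dfrac{c_{i1}(-1)^n+c_{i2}2^n+c_{i3}(-1)^n3^n+c_{i4}5^n+c_{i5}}{c_{i6}}$ with $$\begin{array}{c|cccccc} V_1&220&40&15&1&180&720\\ V_2&40&40&-15&1&-90&720\\ V_3&-8&16&9&1&-18&144\\ V_4&-44&16&-9&1&36&144\\ V_5&0&0&5&1&10&80\\ V_6&20&0&-5&1&0&80\\ V_7&4&4&3&1&0&72\\ V_8&4&4&-3&1&-18&72\\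 V_9&-20&-8&3&1&0&144\\ V_{10}&16&-8&-3&1&18&144\\ V_{11}&-5&-5&0&1&0&45 \end{array}$$ (3) $m=5$: $N^{(5)}_i(n)=\dfrac{c_{i1}(-1)^n+c_{i2}3^{2n}+c_{i3}3^n+c_{i4}}{c_{i5}}$ with $$\begin{array}{c|ccccc} V_1&234&1&30&135&720\\ V_2&54&1&-30&135&720\\ V_3&18&1&6&-9&144\\ V_4&-18&1&-6&-9&144\\ V_5&-26&1&10&15&80\\ V_6&-6&1&-10&15&80\\ V_7&0&1&0&-9&72\\ V_8&0&1&0&-9&72\\ V_9&-18&1&-6&-9&144\\ V_{10}&18&1&6&-9&144\\ V_{11}&9&1&0&0&45 \end{array}$$ (4) $m=6$: $N^{(6)}_i(n)=\dfrac{c_{i1}(-1)^n+c_{i2}3^{2n}+c_{i3}(-1)^n3^n+c_{i4}}{c_{i5}}$ with $$\begin{array}{c|ccccc} V_1&144&1&30&225&720\\ V_2&144&1&-30&45&720\\ V_3&0&1&6&9&144\\ V_4&0&1&-6&-27&144\\ V_5&-16&1&10&5&80\\ V_6&-16&1&-10&25&80\\ V_7&0&1&0&-9&72\\ V_8&0&1&0&-9&72\\ V_9&0&1&-6&-27&144\\ V_{10}&0&1&6&9&144\\ V_{11}&9&1&0&0&45 \end{array}$$ (5) $m=7$: $N^{(7)}_i(n)=\dfrac{c_{i1}(-1)^n+c_{i2}(-1)^n2^n+c_{i3}2^n+c_{i4}2^n5^n+c_{i5}}{c_{i6}}$ with $$\begin{array}{c|cccccc} V_1&120&60&15&1&200&720\\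 V_2&-120&30&-15&1&-40&720\\ V_3&0&6&9&1&-16&144\\ V_4&0&12&-9&1&32&144\\ V_5&0&10&5&1&0&80\\ V_6&0&0&-5&1&0&80\\ V_7&-12&-12&3&1&20&72\\ V_8&12&-6&-3&1&-4&72\\ V_9&24&0&3&1&8&144\\ V_{10}&-24&18&-3&1&8&144\\ V_{11}&0&0&0&1&-10&45 \end{array}$$ (6) $m=8$: $N^{(8)}_i(n)=\dfrac{c_{i1}(-1)^n+c_{i2}(-1)^n2^n+c_{i3}2^n+c_{i4}2^n5^n+c_{i5}}{c_{i6}}$ with $$\begin{array}{c|cccccc} V_1&120&60&15&1&200&720\\ V_2&-120&30&-15&1&-40&720\\ V_3&-24&18&-3&1&8&144\\ V_4&24&0&3&1&8&144\\ V_5&0&10&5&1&0&80\\ V_6&0&0&-5&1&0&80\\ V_7&12&-6&-3&1&-4&72\\ V_8&-12&-12&3&1&20&72\\ V_9&0&12&-9&1&32&144\\ V_{10}&0&6&9&1&-16&144\\ V_{11}&0&0&0&1&-10&45 \end{array}$$ (7) $m=9$: $N^{(9)}_i(n)=\dfrac{c_{i1}(-1)^n+c_{i2}2^n+c_{i3}(-1)^n3^n+c_{i4}5^n+c_{i5}}{c_{i6}}$ with $$\begin{array}{c|cccccc} V_1&220&40&15&1&180&720\\ V_2&40&40&-15&1&-90&720\\ V_3&16&-8&-3&1&18&144\\ V_4&-20&-8&3&1&0&144\\ V_5&0&0&5&1&10&80\\ V_6&20&0&-5&1&0&80\\ V_7&4&4&-3&1&-18&72\\ V_8&4&4&3&1&0&72\\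 V_9&-44&16&-9&1&36&144\\ V_{10}&-8&16&9&1&-18&144\\ V_{11}&-5&-5&0&1&0&45 \end{array}$$ (8) $m=10$: $N^{(10)}_i(n)=\dfrac{c_{i1}(-1)^n+c_{i2}2^n+c_{i3}3^n+c_{i4}5^n+c_{i5}}{c_{i6}}$ with $$\begin{array}{c|cccccc} V_1&265&40&15&1&135&720\\ V_2&-5&40&-15&1&-45&720\\ V_3&7&-8&-3&1&27&144\\ V_4&-11&-8&3&1&-9&144\\ V_5&15&0&5&1&-5&80\\ V_6&5&0&-5&1&15&80\\ V_7&-5&4&-3&1&-9&72\\ V_8&13&4&3&1&-9&72\\ V_9&1&16&-9&1&-9&144\\ V_{10}&-53&16&9&1&27&144\\ V_{11}&-5&-5&0&1&0&45 \end{array}$$ (9) $m=11$: $N^{(11)}_i(n)=\dfrac{c_{i1}2^{4n}+c_{i2}(-1)^n2^n+c_{i3}}{c_{i4}}$ with $$\begin{array}{c|cccc} V_1&1&80&144&720\\ V_2&1&80&144&720\\ V_3&1&8&0&144\\ V_4&1&8&0&144\\ V_5&1&0&-16&80\\ V_6&1&0&-16&80\\ V_7&1&8&0&72\\ V_8&1&8&0&72\\ V_9&1&8&0&144\\ V_{10}&1&8&0&144\\ V_{11}&1&-10&9&45 \end{array}$$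
   Context: All representations are finite-dimensional over $\mathbb{C}$; $V^{\otimes n}$ is the $n$-fold tensor power with diagonal action and $mV$ denotes the direct sum of $m$ copies of $V$. The irreducible complex representation $V_i$ of $S_6$ is the one with character $\chi_i$ in the following table, where the columns are the conjugacy classes of $g_1,\dots,g_{11}$ with the given cycle types and sizes. $$\begin{array}{c|ccccccccccc} & g_1&g_2&g_3&g_4&g_5&g_6&g_7&g_8&g_9&g_{10}&g_{11}\\ \text{cycle type} & 1^6 & 2\,1^4 & 3\,2\,1 & 2^3 & 4\,1^2 & 6 & 2^2 1^2 & 3\,1^3 & 5\,1 & 4\,2 & 3^2\\ \text{size} & 1&15&120&15&90&120&45&40&144&90&40\\ \hline \chi_1&1&1&1&1&1&1&1&1&1&1&1\\ \chi_2&1&-1&-1&-1&-1&-1&1&1&1&1&1\\ \chi_3&5&3&0&-1&1&-1&1&2&0&-1&-1\\ \chi_4&5&-3&0&1&-1&1&1&2&0&-1&-1\\ \chi_5&9&3&0&3&-1&0&1&0&-1&1&0\\ \chi_6&9&-3&0&-3&1&0&1&0&-1&1&0\\ \chi_7&10&2&-1&-2&0&1&-2&1&0&0&1\\ \chi_8&10&-2&1&2&0&-1&-2&1&0&0&1\\ \chi_9&5&1&1&-3&-1&0&1&-1&0&-1&2\\ \chi_{10}&5&-1&-1&3&1&0&1&-1&0&-1&2\\ \chi_{11}&16&0&0&0&0&0&0&-2&1&0&-2 \end{array}$$ *)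

(* Defs.v *)
From HB Require Import structures.
From mathcomp Require Import all_boot all_order all_algebra all_fingroup.
From mathcomp Require Import mxrepresentation character.
From mathcomp Require Import reals complex.
Set Implicit Arguments.
Unset Strict Implicit.
Unset Printing Implicit Defensive.
Import Order.TTheory GRing.Theory Num.Theory.
Local Open Scope ring_scope.

Section TensorPower.
Variables (F : fieldType) (gT : finGroupType) (G : {group gT}).
Implicit Types V W : representation F G.

Definition tensor_grepr V W : representation F G :=
  Representation (prod_repr V W).

Fact unit_grepr_subproof : mx_repr G (fun _ : gT => 1%:M : 'M[F]_1).
Proof. by split=> // g h _ _; rewrite mulmx1. Qed.

Definition unit_grepr : representation F G :=
  Representation (MxRepresentation unit_grepr_subproof).

(* V (x) (V (x) (... (x) V)) with n factors; tensor_power V 1 is V itself, and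
   tensor_power V 0 is the trivial representation. *)
Definition tensor_power V n : representation F G :=
  iterop n tensor_grepr V unit_grepr.
End TensorPower.

(* Lengths of all the cycles of s, fixed points included, in decreasing
   order. *)
Definition cycle_type (s : 'S_6) : seq nat :=
  sort geq [seq #|X| | X : {set 'I_6} in porbits s].

Definition S6_cycle_types : seq (seq nat) :=
  [:: [:: 1; 1; 1; 1; 1; 1];
      [:: 2; 1; 1; 1; 1];
      [:: 3; 2; 1];
      [:: 2; 2; 2];
      [:: 4; 1; 1];
      [:: 6];
      [:: 2; 2; 1; 1];
      [:: 3; 1; 1; 1];
      [:: 5; 1];
      [:: 4; 2];
      [:: 3; 3]]%N.

(* Rows and columns of tables are numbered from 1. *)
Definition entry (t : seq (seq int)) (i j : nat) : int :=
  nth 0 (nth [::] t i.-1) j.-1.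

(* Columns are in the order of S6_cycle_types. *)
Definition S6_chartable : seq (seq int) :=
  [:: [:: 1; 1; 1; 1; 1; 1; 1; 1; 1; 1; 1];
      [:: 1; -1; -1; -1; -1; -1; 1; 1; 1; 1; 1];
      [:: 5; 3; 0; -1; 1; -1; 1; 2; 0; -1; -1];
      [:: 5; -3; 0; 1; -1; 1; 1; 2; 0; -1; -1];
      [:: 9; 3; 0; 3; -1; 0; 1; 0; -1; 1; 0];
      [:: 9; -3; 0; -3; 1; 0; 1; 0; -1; 1; 0];
      [:: 10; 2; -1; -2; 0; 1; -2; 1; 0; 0; 1];
      [:: 10; -2; 1; 2; 0; -1; -2; 1; 0; 0; 1];
      [:: 5; 1; 1; -3; -1; 0; 1; -1; 0; -1; 2];
      [:: 5; -1; -1; 3; 1; 0; 1; -1; 0; -1; 2];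
      [:: 16; 0; 0; 0; 0; 0; 0; -2; 1; 0; -2]].

Definition S6_char (i : nat) (s : 'S_6) : int :=
  entry S6_chartable i (index (cycle_type s) S6_cycle_types).+1.

Definition mult_table3 : seq (seq int) :=
  [:: [:: 265; 40; 15; 1; 135; 720];
      [:: -5; 40; -15; 1; -45; 720];
      [:: -53; 16; 9; 1; 27; 144];
      [:: 1; 16; -9; 1; -9; 144];
      [:: 15; 0; 5; 1; -5; 80];
      [:: 5; 0; -5; 1; 15; 80];
      [:: 13; 4; 3; 1; -9; 72];
      [:: -5; 4; -3; 1; -9; 72];
      [:: -11; -8; 3; 1; -9; 144];
      [:: 7; -8; -3; 1; 27; 144];
      [:: -5; -5; 0; 1; 0; 45]].

Definition mult3 (i n : nat) : rat :=
  let c j := (entry mult_table3 i j)%:~R in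
  (c 1%N * (-1) ^+ n + c 2%N * 2 ^+ n + c 3%N * 3 ^+ n + c 4%N * 5 ^+ n + c 5%N)
  / c 6%N.

Definition mult_table4 : seq (seq int) :=
  [:: [:: 220; 40; 15; 1; 180; 720];
      [:: 40; 40; -15; 1; -90; 720];
      [:: -8; 16; 9; 1; -18; 144];
      [:: -44; 16; -9; 1; 36; 144];
      [:: 0; 0; 5; 1; 10; 80];
      [:: 20; 0; -5; 1; 0; 80];
      [:: 4; 4; 3; 1; 0; 72];
      [:: 4; 4; -3; 1; -18; 72];
      [:: -20; -8; 3; 1; 0; 144];
      [:: 16; -8; -3; 1; 18; 144];
      [:: -5; -5; 0; 1; 0; 45]].

Definition mult4 (i n : nat) : rat :=
  let c j := (entry mult_table4 i j)%:~R in
  (c 1%N * (-1) ^+ n + c 2%N * 2 ^+ n + c 3%N * (-1) ^+ n * 3 ^+ n + c 4%N * 5 ^+ n + c 5%N)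
  / c 6%N.

Definition mult_table5 : seq (seq int) :=
  [:: [:: 234; 1; 30; 135; 720];
      [:: 54; 1; -30; 135; 720];
      [:: 18; 1; 6; -9; 144];
      [:: -18; 1; -6; -9; 144];
      [:: -26; 1; 10; 15; 80];
      [:: -6; 1; -10; 15; 80];
      [:: 0; 1; 0; -9; 72];
      [:: 0; 1; 0; -9; 72];
      [:: -18; 1; -6; -9; 144];
      [:: 18; 1; 6; -9; 144];
      [:: 9; 1; 0; 0; 45]].

Definition mult5 (i n : nat) : rat :=
  let c j := (entry mult_table5 i j)%:~R in
  (c 1%N * (-1) ^+ n + c 2%N * 3 ^+ (2 * n) + c 3%N * 3 ^+ n + c 4%N)
  / c 5%N.

Definition mult_table6 : seq (seq int) :=
  [:: [:: 144; 1; 30; 225; 720];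
      [:: 144; 1; -30; 45; 720];
      [:: 0; 1; 6; 9; 144];
      [:: 0; 1; -6; -27; 144];
      [:: -16; 1; 10; 5; 80];
      [:: -16; 1; -10; 25; 80];
      [:: 0; 1; 0; -9; 72];
      [:: 0; 1; 0; -9; 72];
      [:: 0; 1; -6; -27; 144];
      [:: 0; 1; 6; 9; 144];
      [:: 9; 1; 0; 0; 45]].

Definition mult6 (i n : nat) : rat :=
  let c j := (entry mult_table6 i j)%:~R in
  (c 1%N * (-1) ^+ n + c 2%N * 3 ^+ (2 * n) + c 3%N * (-1) ^+ n * 3 ^+ n + c 4%N)
  / c 5%N.

Definition mult_table7 : seq (seq int) :=
  [:: [:: 120; 60; 15; 1; 200; 720];
      [:: -120; 30; -15; 1; -40; 720];
      [:: 0; 6; 9; 1; -16; 144];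
      [:: 0; 12; -9; 1; 32; 144];
      [:: 0; 10; 5; 1; 0; 80];
      [:: 0; 0; -5; 1; 0; 80];
      [:: -12; -12; 3; 1; 20; 72];
      [:: 12; -6; -3; 1; -4; 72];
      [:: 24; 0; 3; 1; 8; 144];
      [:: -24; 18; -3; 1; 8; 144];
      [:: 0; 0; 0; 1; -10; 45]].

Definition mult7 (i n : nat) : rat :=
  let c j := (entry mult_table7 i j)%:~R in
  (c 1%N * (-1) ^+ n + c 2%N * (-1) ^+ n * 2 ^+ n + c 3%N * 2 ^+ n
   + c 4%N * 2 ^+ n * 5 ^+ n + c 5%N)
  / c 6%N.

Definition mult_table8 : seq (seq int) :=
  [:: [:: 120; 60; 15; 1; 200; 720];
      [:: -120; 30; -15; 1; -40; 720];
      [:: -24; 18; -3; 1; 8; 144];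
      [:: 24; 0; 3; 1; 8; 144];
      [:: 0; 10; 5; 1; 0; 80];
      [:: 0; 0; -5; 1; 0; 80];
      [:: 12; -6; -3; 1; -4; 72];
      [:: -12; -12; 3; 1; 20; 72];
      [:: 0; 12; -9; 1; 32; 144];
      [:: 0; 6; 9; 1; -16; 144];
      [:: 0; 0; 0; 1; -10; 45]].

Definition mult8 (i n : nat) : rat :=
  let c j := (entry mult_table8 i j)%:~R in
  (c 1%N * (-1) ^+ n + c 2%N * (-1) ^+ n * 2 ^+ n + c 3%N * 2 ^+ n
   + c 4%N * 2 ^+ n * 5 ^+ n + c 5%N)
  / c 6%N.

Definition mult_table9 : seq (seq int) :=
  [:: [:: 220; 40; 15; 1; 180; 720];
      [:: 40; 40; -15; 1; -90; 720];
      [:: 16; -8; -3; 1; 18; 144];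
      [:: -20; -8; 3; 1; 0; 144];
      [:: 0; 0; 5; 1; 10; 80];
      [:: 20; 0; -5; 1; 0; 80];
      [:: 4; 4; -3; 1; -18; 72];
      [:: 4; 4; 3; 1; 0; 72];
      [:: -44; 16; -9; 1; 36; 144];
      [:: -8; 16; 9; 1; -18; 144];
      [:: -5; -5; 0; 1; 0; 45]].

Definition mult9 (i n : nat) : rat :=
  let c j := (entry mult_table9 i j)%:~R in
  (c 1%N * (-1) ^+ n + c 2%N * 2 ^+ n + c 3%N * (-1) ^+ n * 3 ^+ n + c 4%N * 5 ^+ n + c 5%N)
  / c 6%N.

Definition mult_table10 : seq (seq int) :=
  [:: [:: 265; 40; 15; 1; 135; 720];
      [:: -5; 40; -15; 1; -45; 720];
      [:: 7; -8; -3; 1; 27; 144];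
      [:: -11; -8; 3; 1; -9; 144];
      [:: 15; 0; 5; 1; -5; 80];
      [:: 5; 0; -5; 1; 15; 80];
      [:: -5; 4; -3; 1; -9; 72];
      [:: 13; 4; 3; 1; -9; 72];
      [:: 1; 16; -9; 1; -9; 144];
      [:: -53; 16; 9; 1; 27; 144];
      [:: -5; -5; 0; 1; 0; 45]].

Definition mult10 (i n : nat) : rat :=
  let c j := (entry mult_table10 i j)%:~R in
  (c 1%N * (-1) ^+ n + c 2%N * 2 ^+ n + c 3%N * 3 ^+ n + c 4%N * 5 ^+ n + c 5%N)
  / c 6%N.

Definition mult_table11 : seq (seq int) :=
  [:: [:: 1; 80; 144; 720];
      [:: 1; 80; 144; 720];
      [:: 1; 8; 0; 144];
      [:: 1; 8; 0; 144];
      [:: 1; 0; -16; 80];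
      [:: 1; 0; -16; 80];
      [:: 1; 8; 0; 72];
      [:: 1; 8; 0; 72];
      [:: 1; 8; 0; 144];
      [:: 1; 8; 0; 144];
      [:: 1; -10; 9; 45]].

Definition mult11 (i n : nat) : rat :=
  let c j := (entry mult_table11 i j)%:~R in
  (c 1%N * 2 ^+ (4 * n) + c 2%N * (-1) ^+ n * 2 ^+ n + c 3%N)
  / c 4%N.

Definition S6_mult (m : nat) : nat -> nat -> rat :=
  match m with
  | 3%N => mult3
  | 4%N => mult4
  | 5%N => mult5
  | 6%N => mult6
  | 7%N => mult7
  | 8%N => mult8
  | 9%N => mult9
  | 10%N => mult10
  | 11%N => mult11
  | _ => fun _ _ => 0
  end.

(* Main.v *)
Require Import Defs.
From HB Require Import structures.
From mathcomp Require Import all_boot all_order all_algebra all_fingroup.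
From mathcomp Require Import pgroup.
From mathcomp Require Import mxrepresentation character.
From mathcomp Require Import reals complex.
From mathcomp Require Import ring.

(** Write [S6] for the symmetric group on six points.  Two facts are proved
    separately and then combined.

    Existence of a decomposition.  The eleven given irreducible
    representations have pairwise distinct characters, because two equal rows
    of the character table would contradict row orthogonality; hence they are
    pairwise non-isomorphic.  The squares of their degrees add up to [6! = 720],
    the order of the group, so by Wedderburn's count they exhaust the
    irreducible representations ([irr_complete]).  By Maschke every
    representation, in particular the tensor power of [V m], is then a direct
    sum of [N i] copies of each [V i] ([rsim_dsum_irr]).

    Identification of the multiplicities.  Taking traces, at a permutation of
    each of the eleven cycle types, gives
    [chi_m (g_j) ^+ n = \sum_k N k * chi_k (g_j)] for all [j].  Row
    orthogonality of the explicit table inverts this linear system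
    ([S6_multiplicity]):
    [720 * N i = \sum_j |class j| * chi_i (g_j) * chi_m (g_j) ^+ n].
    Orthogonality enters here as an identity between the entries of the table,
    checked by computation; the link with the group is that every column is
    realised by some permutation ([S6_cycle_typeP]).

    Both this last expression and the numerator of the closed formula are
    exponential sums [\sum c * v ^+ n].  For [n >= 1] terms with [v = 0]
    vanish, and two exponential sums agree as soon as each nonzero base [v] has
    the same total coefficient in both ([expsum_eq]).  The 99 formulas
    thereby reduce to one finite integer computation ([S6_multE]). *)

Set Implicit Arguments.
Unset Strict Implicit.
Unset Printing Implicit Defensive.
Import Order.TTheory GRing.Theory Num.Theory.
Local Open Scope ring_scope.

(** * Traces of sums and tensor powers *)

Section Traces.
Variables (F : fieldType) (gT : finGroupType) (G : {group gT}).
Implicit Types rG : representation F G.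

Lemma mxtrace_dsum_grepr (I : Type) (r : seq I) (P : pred I)
    (rG : I -> representation F G) g :
  \tr ((\big[dadd_grepr/grepr0]_(i <- r | P i) rG i) g)
    = \sum_(i <- r | P i) \tr (rG i g).
Proof.
apply: (big_morph (fun W : representation F G => \tr (W g))) => [rG1 rG2|].
  exact: mxtrace_block.
by rewrite [\tr _]mxtrace1.
Qed.

Lemma mxtrace_muln_grepr rG k g : \tr (muln_grepr rG k g) = \tr (rG g) *+ k.
Proof. by rewrite mxtrace_dsum_grepr sumr_const card_ord. Qed.

Lemma mxtrace_tensor_power rG n g :
  \tr (tensor_power rG n g) = \tr (rG g) ^+ n.
Proof.
case: n => [|n]; first exact: mxtrace1.
rewrite /tensor_power iteropS; elim: n => [|n IHn] //.
by rewrite iterS exprS -IHn [LHS]mxtrace_prod.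
Qed.

End Traces.

(** * Decomposition along a complete family of irreducibles *)

Section Decomposition.
Variables (F : decFieldType) (gT : finGroupType) (G : {group gT}).
Hypothesis F'G : pgroup [pchar F]^'%N G.

(** Maschke writes [W] as a direct sum of simple submodules [U j]; grouping the
    [j] by the [V i] to which [U j] is isomorphic turns that sum into a
    sum of isotypic blocks, whose sizes are the multiplicities. *)
Lemma rsim_dsum_irr (I : finType) (V : I -> representation F G)
    (V_all : forall rG : representation F G,
       mx_irreducible rG -> exists i, mx_rsim rG (V i))
    (W : representation F G) :
  exists N : I -> nat,
    mx_rsim W (\big[dadd_grepr/grepr0]_i muln_grepr (V i) (N i)).
Proof.
have [J U /= simU defW dxW] :=
  dec_mx_reducible_semisimple (mxmodule1 W) (mx_Maschke_pchar W F'G).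
pose modU j := mxsimple_module (simU j).
have irrU j : exists i, mx_rsim (submod_repr (modU j)) (V i).
  apply: (V_all (Representation (submod_repr (modU j)))).
  exact/submod_mx_irr.
have [type_of simV] := fin_all_exists irrU.
exists (fun i => #|[pred j | type_of j == i]|).
apply: mx_rsim_trans (mx_rsim_sym (rsim_submod1 (mxmodule1 W) _)) _ => //.
have /mxdirect_sumsE[/= dx_isotypic dx_type] :
    mxdirect (\sum_i \sum_(j | type_of j == i) U j).
  move: dxW; rewrite !mxdirectE /=.
  by rewrite !(partition_big type_of xpredT).
have mod_isotypic i : mxmodule W (\sum_(j | type_of j == i) U j)%MS.
  by apply: sumsmx_module => j _; apply: modU.
apply: mx_rsim_dsum (mod_isotypic) _ _ dx_type _ => [|i].
  by apply: eqmx_trans defW; rewrite (partition_big type_of xpredT).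
(* Both sides are the same iterate of [dadd_grepr (V i)], which gives an
   equality of representations and not only an isomorphism. *)
have -> : muln_grepr (V i) #|[pred j | type_of j == i]|
    = \big[dadd_grepr/grepr0]_(j | type_of j == i) V (type_of j).
  under [RHS]eq_bigr => j /eqP-> do over.
  by rewrite /muln_grepr !big_const card_ord.
exact: mx_rsim_dsum (modU) _ (eqmx_refl _) (dx_isotypic i isT) simV.
Qed.

End Decomposition.

Section Complete.
Variables (F : closedFieldType) (gT : finGroupType) (G : {group gT}).
Hypothesis F'G : pgroup [pchar F]^'%N G.

(** The squares of the degrees of all irreducible representations add up to
    [#|G|].  Non-isomorphic [V i] occupy distinct terms of that sum, and if
    their own squares already reach [#|G|], every other term would be zero;
    but degrees are positive. *)
Lemma irr_complete (I : finType) (V : I -> representation F G)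
    (V_irr : forall i, mx_irreducible (V i))
    (V_neq : forall i j, mx_rsim (V i) (V j) -> i = j)
    (V_degree : (\sum_i rdegree (V i) ^ 2 = #|G|)%N)
    (rG : representation F G) :
  mx_irreducible rG -> exists i, mx_rsim rG (V i).
Proof.
move=> irr_rG; pose sG : irrType F G := DecSocleType _.
have splitG : group_splitting_field F G by exact: group_closure_closed_field.
pose h i := irr_comp sG (V i).
have simh i : mx_rsim (V i) (irr_repr (h i)) by exact: rsim_irr_comp_pchar.
have h_inj : injective h.
  move=> i j eq_h; apply: V_neq; apply: mx_rsim_trans (simh i) _.
  by rewrite eq_h; apply: mx_rsim_sym.
have degh i : irr_degree (h i) = rdegree (V i) by case: (simh i).
have sum_h : (\sum_(j in codom h) irr_degree j ^ 2 = #|G|)%N.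
  rewrite -big_uniq ?big_image /=; last by rewrite map_inj_uniq ?enum_uniq.
  by rewrite -V_degree; apply: eq_bigr => i _; rewrite degh.
have /imageP[i _ eq_hi] : irr_comp sG rG \in codom h.
  apply: contraT => notin_h.
  have /eqP := sum_irr_degree_pchar sG F'G splitG.
  rewrite (bigID (mem (codom h))) /= sum_h -[X in _ == X]addn0 eqn_add2l.
  rewrite (bigD1 (irr_comp sG rG)) //= addn_eq0 expn_eq0.
  by rewrite gtn_eqF ?irr_degree_gt0.
exists i; apply: mx_rsim_trans (rsim_irr_comp_pchar sG F'G irr_rG) _.
by rewrite eq_hi; apply: mx_rsim_sym.
Qed.

End Complete.

(** * Permutations with prescribed cycle lengths *)

Section CycleLengths.
Variable T : finType.
Implicit Types (s : {perm T}) (c : seq (seq T)).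

(** The conclusion that [s] fixes all points outside the cycles is what lets the
    induction go through: it makes [s] compatible with the
    rotation of one more, disjoint, cycle. *)
Lemma perm_of_fcycles c : uniq (flatten c) ->
  exists s, all (fcycle s) c /\ (forall x, x \notin flatten c -> s x = x).
Proof.
elim: c => [_ | p c IHc] /=.
  by exists 1%g; split=> // x _; rewrite perm1.
rewrite cat_uniq => /and3P[Up /hasPn p'c /IHc[s [s_c s_id]]].
have s_p x : x \in p -> s x = x.
  by move=> px; apply: s_id; apply: contraL px; apply: p'c.
pose f x := if x \in p then next p x else s x.
have f_p x : x \in p -> f x \in p by rewrite /f => px; rewrite px mem_next.
have f_notp x : x \notin p -> f x \notin p.
  rewrite /f => p'x; rewrite (negPf p'x); apply: contra p'x => /[dup] psx.
  by move/s_p/perm_inj <-.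
have f_inj : injective f.
  move=> x y eq_f; have [px | p'x] := boolP (x \in p); last first.
    have := f_notp x p'x; rewrite eq_f => /(contra (f_p y)) p'y.
    by move: eq_f; rewrite /f (negPf p'x) (negPf p'y) => /perm_inj.
  have := f_p x px; rewrite eq_f => /(contraTT (f_notp y)) py.
  by move: eq_f; rewrite /f px py; apply: (can_inj (prev_next Up)).
exists (perm f_inj); split=> [|x]; last first.
  rewrite mem_cat negb_or permE /f => /andP[/negPf-> ?]; exact: s_id.
apply/andP; split.
  have eq_p : {in mem p &, frel (perm f_inj) =2 frel (next p)}.
    by move=> x y px _ /=; rewrite permE /f px.
  by rewrite (eq_in_cycle eq_p) ?cycle_next //; apply/allP.
have eq_c : {in mem (flatten c) &, frel (perm f_inj) =2 frel s}.
  by move=> x y cx _ /=; rewrite permE /f (negPf (p'c x cx)).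
apply/allP => q qc; rewrite (eq_in_cycle eq_c); first exact: (allP s_c).
by apply/allP => x qx; apply/flattenP; exists q.
Qed.

(** The orbits of [s] are the supports of the listed cycles.  Empty lists are
    excluded because they would count as orbits of size zero. *)
Lemma card_porbits_fcycles s c :
    uniq (flatten c) -> (forall x, x \in flatten c) -> [::] \notin c ->
    all (fcycle s) c ->
  perm_eq [seq #|X| | X : {set T} in porbits s] (shape c).
Proof.
move=> Uc c_all c_nil s_c.
have porbit_c p x : p \in c -> x \in p -> porbit s x = [set y in p].
  move=> cp px; apply/setP => y; rewrite inE.
  rewrite -(fconnect_cycle (allP s_c p cp) px).
  apply/porbitP/idP => [[k ->] | /iter_findex <-].
    by rewrite permX; apply: fconnect_iter.
  by exists (findex s x y); rewrite permX.
have perm_porbits :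
    perm_eq (enum (porbits s)) [seq [set y in p] | p : seq T <- c].
  apply: uniq_perm => [||X]; first exact: enum_uniq.
    elim: c Uc c_nil {c_all s_c porbit_c} => //= p c IHc.
    rewrite cat_uniq inE negb_or => /and3P[_ /hasPn p'c Uc] /andP[p_nil c_nil].
    rewrite IHc // andbT; apply/mapP=> -[q qc /setP eq_pq].
    case: p p_nil p'c eq_pq => // x p _ p'c /(_ x).
    rewrite !inE eqxx /= => /esym qx; have /p'c : x \in flatten c.
      by apply/flattenP; exists q.
    by rewrite mem_head.
  rewrite mem_enum; apply/imsetP/mapP => [[x _ ->] | [p pc ->]].
    have /flattenP[p pc px] := c_all x.
    by exists p => //; apply: porbit_c.
  case: p pc => [|x p] pc; first by rewrite pc in c_nil.
  by exists x => //; rewrite (porbit_c _ _ pc) ?mem_head.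
apply: perm_trans (perm_map _ perm_porbits) _; rewrite -map_comp.
rewrite (_ : map _ c = shape c) //; apply/eq_in_map => p pc /=.
rewrite cardsE; apply/card_uniqP; move: Uc.
by rewrite (perm_uniq (perm_flatten (perm_to_rem pc))) cat_uniq => /andP[].
Qed.

(** Cut an enumeration of [T] into consecutive blocks of the given lengths and
    rotate each block. *)
Lemma perm_of_cycle_lengths (sh : seq nat) : sumn sh = #|T| -> 0%N \notin sh ->
  exists s : {perm T}, perm_eq [seq #|X| | X : {set T} in porbits s] sh.
Proof.
move=> sum_sh sh_gt0; pose c := reshape sh (enum T).
have flat_c : flatten c = enum T by rewrite reshapeKr // sum_sh cardT.
have sh_c : shape c = sh by rewrite reshapeKl // sum_sh cardT.
have Uc : uniq (flatten c) by rewrite flat_c enum_uniq.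
have [s [s_c _]] := perm_of_fcycles Uc; exists s; rewrite -sh_c.
apply: card_porbits_fcycles => // [x|]; first by rewrite flat_c mem_enum.
apply: contra sh_gt0; rewrite -sh_c; exact: (map_f size).
Qed.

End CycleLengths.

Lemma cycle_typeE (s : 'S_6) (sh : seq nat) :
    perm_eq [seq #|X| | X : {set 'I_6} in porbits s] sh -> sorted geq sh ->
  cycle_type s = sh.
Proof.
have geq_trans : transitive geq.
  by move=> y x z le_yx le_zy; apply: leq_trans le_zy le_yx.
have geq_anti : antisymmetric geq.
  by move=> x y; rewrite andbC -eqn_leq => /eqP.
have geq_total : total geq by move=> x y; apply: leq_total.
move=> /(perm_sortP geq_total geq_trans geq_anti) eq_sort.
by move/(sorted_sort geq_trans); rewrite /cycle_type eq_sort.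
Qed.

Lemma S6_cycle_typeP j : (j < 11)%N ->
  exists s : 'S_6, index (cycle_type s) S6_cycle_types = j.
Proof.
move=> lt_j; pose sh := nth [::] S6_cycle_types j.
have sh_in : sh \in S6_cycle_types by rewrite mem_nth.
have [||s perm_sh] := @perm_of_cycle_lengths 'I_6 sh.
- rewrite card_ord; apply/eqP; move: sh sh_in; exact/allP.
- move: sh sh_in; exact/allP.
exists s; rewrite (cycle_typeE perm_sh) ?index_uniq //.
move: sh sh_in {perm_sh}; exact/allP.
Qed.

Lemma cycle_type1 : cycle_type 1%g = nseq 6 1%N.
Proof.
pose c : seq (seq 'I_6) := [seq [:: x] | x <- enum 'I_6].
have flat_c : flatten c = enum 'I_6.
  by rewrite /c; elim: (enum _) => //= x e ->.
have sh_c : shape c = nseq 6 1%N.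
  rewrite /shape -map_comp -[in RHS](size_enum_ord 6).
  by elim: (enum _) => //= x e ->.
apply: cycle_typeE => //; rewrite -sh_c.
apply: card_porbits_fcycles => [|x||]; rewrite ?flat_c ?enum_uniq ?mem_enum //.
  by apply/mapP=> -[].
by apply/allP=> _ /mapP[x _ ->]; rewrite /= perm1 eqxx.
Qed.

(** * The character table and exponential sums *)

Definition S6_class_sizes : seq int :=
  [:: 1; 15; 120; 15; 90; 120; 45; 40; 144; 90; 40].

(** Weighting the columns by class sizes makes the transposed table its own
    inverse up to the factor 720; this is how multiplicities are recovered
    from the values of a character. *)
Lemma S6_row_orthogonality i k : (1 <= i <= 11)%N -> (1 <= k <= 11)%N ->
  \sum_(j <- iota 0 11) S6_class_sizes`_j
      * entry S6_chartable i j.+1 * entry S6_chartable k j.+1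
    = 720 * (i == k)%:R.
Proof.
move=> i_bounds k_bounds; apply/eqP.
have i_in : i \in iota 1 11 by rewrite mem_iota.
have k_in : k \in iota 1 11 by rewrite mem_iota.
move: k k_in {k_bounds}; apply/allP; move: i i_in {i_bounds}; apply/allP.
by rewrite unlock; vm_compute.
Qed.

(** A list of pairs (coefficient, base) encodes the function
    [n |-> \sum c * v ^+ n]; the encoding makes equality of such functions a
    decidable question about lists. *)
Definition expsum (L : seq (int * int)) (n : nat) : int :=
  \sum_(p <- L) p.1 * p.2 ^+ n.

Definition expsum_coef (L : seq (int * int)) (v : int) : int :=
  \sum_(p <- L | p.2 == v) p.1.

Lemma expsum_collect L (B : seq int) n : uniq B -> {subset unzip2 L <= B} ->
  expsum L n = \sum_(v <- B) expsum_coef L v * v ^+ n.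
Proof.
move=> UB sLB; rewrite /expsum_coef; under eq_bigr do rewrite mulr_suml.
rewrite (exchange_big_dep predT) //= /expsum.
rewrite big_seq [RHS]big_seq; apply: eq_bigr => p Lp.
have BP : p.2 \in B by rewrite sLB // map_f.
rewrite (eq_bigl (pred1 p.2)); last first.
  by move=> v; rewrite /= eq_sym.
by rewrite -big_filter (filter_pred1_uniq UB BP) big_seq1.
Qed.

Definition expsum_eqb (L1 L2 : seq (int * int)) : bool :=
  all (fun v => (v == 0) || (expsum_coef L1 v == expsum_coef L2 v))
      (unzip2 (L1 ++ L2)).

(** Collecting terms by base; the hypothesis on [n] is what allows the base 0,
    which occurs wherever the character of [V m] vanishes, to be ignored. *)
Lemma expsum_eq L1 L2 n : (0 < n)%N -> expsum_eqb L1 L2 ->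
  expsum L1 n = expsum L2 n.
Proof.
move=> n_gt0 /allP eqL; pose B := undup (unzip2 (L1 ++ L2)).
have mem_B v : (v \in B) = (v \in unzip2 L1) || (v \in unzip2 L2).
  by rewrite mem_undup /unzip2 map_cat mem_cat.
rewrite !(@expsum_collect _ B) ?undup_uniq //; first last.
- by move=> v Lv; rewrite mem_B Lv.
- by move=> v Lv; rewrite mem_B Lv orbT.
apply: eq_big_seq => v; rewrite mem_undup => /eqL /orP[/eqP-> | /eqP-> //].
by rewrite expr0n gtn_eqF ?mulr0.
Qed.

Lemma expsum_scale a L n :
  expsum [seq (a * p.1, p.2) | p <- L] n = a * expsum L n.
Proof.
by rewrite /expsum big_map mulr_sumr; under eq_bigr do rewrite -mulrA.
Qed.

Lemma intr_expsum L n :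
  (expsum L n)%:~R = \sum_(p <- L) p.1%:~R * p.2%:~R ^+ n :> rat.
Proof. by rewrite rmorph_sum; under eq_bigr do rewrite rmorphM rmorphXn. Qed.

(** The terms of [\sum_j |class j| * chi_i (g_j) * chi_m (g_j) ^+ n], which is
    720 times the scalar product of [chi_i] with [chi_m ^+ n]. *)
Definition S6_char_terms (m i : nat) : seq (int * int) :=
  [seq (S6_class_sizes`_j * entry S6_chartable i j.+1, entry S6_chartable m j.+1)
  | j <- iota 0 11].

Definition mult_table (m : nat) : seq (seq int) :=
  nth [::] [:: mult_table3; mult_table4; mult_table5; mult_table6; mult_table7;
               mult_table8; mult_table9; mult_table10; mult_table11] (m - 3).

(** The bases that accompany the successive columns of [mult_table m]: mixed
    powers are merged, as in [(-1) ^+ n * 3 ^+ n = (-3) ^+ n] or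
    [3 ^+ (2 * n) = 9 ^+ n], and 1 is the base of the constant term. *)
Definition mult_bases (m : nat) : seq int :=
  nth [::] [:: [:: -1; 2; 3; 5; 1]; [:: -1; 2; -3; 5; 1]; [:: -1; 9; 3; 1];
               [:: -1; 9; -3; 1]; [:: -1; -2; 2; 10; 1]; [:: -1; -2; 2; 10; 1];
               [:: -1; 2; -3; 5; 1]; [:: -1; 2; 3; 5; 1]; [:: 16; -2; 1]] (m - 3).

Definition mult_terms (m i : nat) : seq (int * int) :=
  [seq (entry (mult_table m) i k.+1, (mult_bases m)`_k)
  | k <- iota 0 (size (mult_bases m))].

Definition mult_denominator (m i : nat) : int :=
  entry (mult_table m) i (size (mult_bases m)).+1.

Lemma S6_mult_expsum m i n : (3 <= m <= 11)%N ->
  S6_mult m i n = (expsum (mult_terms m i) n)%:~R / (mult_denominator m i)%:~R.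
Proof.
move=> m_bounds.
have m_in : m \in iota 3 9 by rewrite mem_iota.
have pow1 : (1%:~R : rat) ^+ n = 1 by rewrite expr1n.
have pow9 : (9%:~R : rat) ^+ n = 3 ^+ (2 * n) by rewrite exprM.
have pow10 : (10%:~R : rat) ^+ n = 2 ^+ n * 5 ^+ n by rewrite -exprMn.
have pow16 : (16%:~R : rat) ^+ n = 2 ^+ (4 * n) by rewrite exprM.
have powN2 : ((-2)%:~R : rat) ^+ n = (-1) ^+ n * 2 ^+ n by rewrite -exprMn.
have powN3 : ((-3)%:~R : rat) ^+ n = (-1) ^+ n * 3 ^+ n by rewrite -exprMn.
rewrite intr_expsum big_map; move: m_in; rewrite !inE.
by do 8?[case/predU1P => [-> | ]]; last move/eqP->;
  rewrite /= !big_cons big_nil /= ?(pow1, pow9, pow10, pow16, powN2, powN3);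
  rewrite /mult3 /mult4 /mult5 /mult6 /mult7 /mult8 /mult9 /mult10 /mult11;
  rewrite /mult_table /=; congr (_ / _); ring.
Qed.

(** After cross-multiplying the denominators 720 and [mult_denominator m i],
    collected coefficients can be compared by computation, for all [m] and
    [i] at once. *)
Lemma S6_multE m i n : (3 <= m <= 11)%N -> (1 <= i <= 11)%N -> (0 < n)%N ->
  S6_mult m i n = (expsum (S6_char_terms m i) n)%:~R / 720%:~R.
Proof.
move=> m_bounds i_bounds n_gt0; rewrite S6_mult_expsum //.
have /andP[d_neq0 eq_terms] : (mult_denominator m i != 0) &&
    expsum_eqb [seq (720 * p.1, p.2) | p <- mult_terms m i]
      [seq (mult_denominator m i * p.1, p.2) | p <- S6_char_terms m i].
  have i_in : i \in iota 1 11 by rewrite mem_iota.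
  have m_in : m \in iota 3 9 by rewrite mem_iota.
  move: i i_in {i_bounds}; apply/allP; move: m m_in {m_bounds}; apply/allP.
  by rewrite /expsum_eqb /expsum_coef unlock; vm_compute.
have := expsum_eq n_gt0 eq_terms; rewrite !expsum_scale.
move: (expsum _ n) (expsum _ n) => x y eq_xy.
have card_neq0 : (720 : int) != 0 by [].
(* 720 is generalised so that later steps do not try to evaluate it. *)
move: (720 : int) card_neq0 eq_xy => g g_neq0 eq_xy.
apply/eqP; rewrite eqr_div ?intr_eq0 // -!rmorphM /=.
by rewrite mulrC eq_xy mulrC.
Qed.

(** * Representations of S6 *)

Section S6.
Variables (R : realType) (V : nat -> representation R[i] [set: 'S_6]).
Hypothesis irrV : forall i, (1 <= i <= 11)%N -> mx_irreducible (V i).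
Hypothesis charV : forall i, (1 <= i <= 11)%N ->
  forall s : 'S_6, \tr (V i s) = (S6_char i s)%:~R.

Lemma S6_pchar : pgroup [pchar R[i]]^'%N [set: 'S_6].
Proof. by apply/pgroupP=> p _ _; rewrite inE /= pchar_num. Qed.

(** Isomorphic [V i] and [V k] have equal rows in the table, so the scalar product
    of rows [i] and [k] is that of row [i] with itself, which is not zero. *)
Lemma S6_irr_neq i k : (1 <= i <= 11)%N -> (1 <= k <= 11)%N ->
  mx_rsim (V i) (V k) -> i = k.
Proof.
move=> i_bounds k_bounds sim_ik; apply/eqP.
have eq_row j : (j < 11)%N ->
    entry S6_chartable i j.+1 = entry S6_chartable k j.+1.
  case/S6_cycle_typeP=> s <-; apply: (@intr_inj R[i]).
  by have := mxtrace_rsim sim_ik (in_setT s); rewrite !charV.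
have := S6_row_orthogonality i_bounds k_bounds.
rewrite (eq_big_seq (fun j => S6_class_sizes`_j
  * entry S6_chartable i j.+1 * entry S6_chartable i j.+1)); last first.
  by move=> j; rewrite mem_iota => /eq_row->.
by rewrite S6_row_orthogonality // eqxx; case: eqP.
Qed.

Lemma S6_irr_degree i : (1 <= i <= 11)%N ->
  rdegree (V i) = `|entry S6_chartable i 1|%N.
Proof.
move=> i_bounds; have := charV i_bounds 1%g.
rewrite repr_mx1 mxtrace1 /S6_char cycle_type1 pmulrn => /intr_inj /= <-.
by [].
Qed.

Lemma S6_sum_degree : (\sum_(i < 11) rdegree (V i.+1) ^ 2 = #|[set: 'S_6]|)%N.
Proof.
rewrite cardsT card_Sn.
under eq_bigr do rewrite S6_irr_degree ?ltn_ord //.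
rewrite -(big_mkord predT (fun i => `|entry S6_chartable i.+1 1| ^ 2)%N).
by rewrite unlock.
Qed.

Lemma S6_decomposition (W : representation R[i] [set: 'S_6]) :
  exists N : nat -> nat,
    mx_rsim W (\big[dadd_grepr/grepr0]_(1 <= i < 12) muln_grepr (V i) (N i)).
Proof.
pose V' (i : 'I_11) := V i.+1.
have V_all (rG : representation R[i] [set: 'S_6]) :
      mx_irreducible rG -> exists i, mx_rsim rG (V' i).
  have V_irr i : mx_irreducible (V' i) by apply: irrV; exact: ltn_ord.
  have V_neq i k : mx_rsim (V' i) (V' k) -> i = k.
    by move/S6_irr_neq => eq_ik; apply/val_inj/succn_inj/eq_ik; exact: ltn_ord.
  exact: (irr_complete S6_pchar V_irr V_neq S6_sum_degree).
have [N simN] := rsim_dsum_irr S6_pchar V_all W.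
exists (fun i => N (inord i.-1)); rewrite big_add1 big_mkord /=.
by under eq_bigr do rewrite inord_val.
Qed.

(** The character identity is read off at one permutation of each cycle type and
    paired with row [i] of the table; orthogonality isolates [N i]. *)
Lemma S6_multiplicity (N : nat -> nat) m n i :
    (1 <= m <= 11)%N -> (1 <= i <= 11)%N ->
    mx_rsim (tensor_power (V m) n)
            (\big[dadd_grepr/grepr0]_(1 <= i < 12) muln_grepr (V i) (N i)) ->
  expsum (S6_char_terms m i) n = 720 * (N i)%:Z.
Proof.
move=> m_bounds i_bounds simW.
have charW j : (j < 11)%N -> entry S6_chartable m j.+1 ^+ n
    = \sum_(1 <= k < 12) entry S6_chartable k j.+1 * (N k)%:Z.
  case/S6_cycle_typeP=> s <-; apply: (@intr_inj R[i]).
  have := mxtrace_rsim simW (in_setT s).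
  rewrite mxtrace_tensor_power charV // mxtrace_dsum_grepr rmorphXn /= => ->.
  rewrite rmorph_sum /=; apply: eq_big_nat => k k_bounds.
  by rewrite mxtrace_muln_grepr charV // rmorphM /= mulr_natr.
rewrite /expsum big_map.
rewrite (eq_big_seq (fun j => \sum_(1 <= k < 12) S6_class_sizes`_j
  * entry S6_chartable i j.+1 * entry S6_chartable k j.+1 * (N k)%:Z));
  last first.
  move=> j; rewrite mem_iota => /charW /= ->; rewrite mulr_sumr.
  by apply: eq_bigr => k _; rewrite mulrA.
rewrite exchange_big /=.
under eq_big_nat => k k_bounds.
  rewrite -mulr_suml S6_row_orthogonality //.
over.
rewrite (bigD1_seq i) ?mem_index_iota ?iota_uniq //= eqxx mulr1 big1 ?addr0 //.
by move=> k /negPf; rewrite eq_sym => ->; rewrite mulr0 mul0r.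
Qed.

End S6.

Theorem theorem7 (R : realType)
    (V : nat -> representation R[i] [set: 'S_6])
    (irrV : forall i, (1 <= i <= 11)%N -> mx_irreducible (V i))
    (charV : forall i, (1 <= i <= 11)%N ->
       forall s : 'S_6, \tr (V i s) = (S6_char i s)%:~R)
    (n : nat) (n_ge1 : (1 <= n)%N) (m : nat) (m_bounds : (3 <= m <= 11)%N) :
  exists N : nat -> nat,
    (forall i, (1 <= i <= 11)%N -> (N i)%:R = S6_mult m i n :> rat) /\
    mx_rsim (tensor_power (V m) n)
            (\big[dadd_grepr/grepr0]_(1 <= i < 12) muln_grepr (V i) (N i)).
Proof.
have [N simN] := S6_decomposition irrV charV (tensor_power (V m) n).
exists N; split=> // i i_bounds.
have m_ge1 : (1 <= m <= 11)%N by case/andP: m_bounds => /(ltn_trans _)->.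
rewrite S6_multE // (S6_multiplicity charV m_ge1 i_bounds simN).
by rewrite rmorphM /= mulrAC divff ?mul1r ?intr_eq0 // -pmulrn.
Qed.
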